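(* The space $C(\mathbb N^* )=\ell_\infty/c_0$ is $(1,\aleph_1)$-injective.
   Context: $\mathbb N^*=\beta\mathbb N\setminus\mathbb N$ is the growth of the integers in the Stone--Čech compactification, and $C(\mathbb N^* )$ is the Banach space of real-valued continuous functions on it with the sup norm, identified with $\ell_\infty/c_0$. All Banach spaces are real, ''operator'' means bounded linear map, ''subspace'' means closed linear subspace, and $\operatorname{dens}(X)$ is the smallest cardinality of a dense subset of $X$. For an uncountable cardinal $\aleph$, a Banach space $E$ is $(1,\aleph)$-injective if for every Banach space $X$ with $\operatorname{dens}(X)<\aleph$ and every subspace $Y\subset X$, every operator $t:Y\to E$ has an extension to an operator $T:X\to E$ with $\|T\|\leq\|t\|$. *)

(* Defs.v *)
From HB Require Import structures.
From mathcomp Require Import all_boot all_order all_algebra.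
From mathcomp Require Import ring.
From mathcomp Require Import all_classical all_reals all_analysis.
Import Order.TTheory GRing.Theory Num.Theory.
Import numFieldNormedType.Exports.

Set Implicit Arguments.
Unset Strict Implicit.
Unset Printing Implicit Defensive.

Local Open Scope classical_set_scope.
Local Open Scope card_scope.
Local Open Scope ring_scope.

Definition card_lt T U (A : set T) (B : set U) := (A #<= B) && ~~ (B #<= A).

(* Well-foundedness of cardinals.  In a maximal set of choice functions on which
   all the projections are injective, one of the projections is also onto. *)
Lemma card_le_min (I : Type) (T : I -> Type) (F : forall i, set (T i)) (i0 : I) :
  exists i, forall j, F i #<= F j.
Proof.
pose P (S : set (forall i, T i)) :=
  (forall g, S g -> forall i, F i (g i)) /\
  (forall g h i, S g -> S h -> g i = h i -> g = h).
have [|S [[SF Sinj] Smax]] := @Zorn_bigcup _ P.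
  move=> C CP Ctot; split=> [g [X CX Xg] i|g h i [X CX Xg] [Y CY Yh] ghi].
    exact: (CP _ CX).1.
  have [XY|YX] := Ctot _ _ CX CY.
    by apply: ((CP _ CY).2 _ _ i) => //; exact: XY.
  by apply: ((CP _ CX).2 _ _ i) => //; exact: YX.
have [i iF] : exists i, forall y, F i y -> exists2 g, S g & g i = y.
  apply: contrapT => /forallNP nF.
  have {}nF i : {y | F i y /\ forall g, S g -> g i <> y}.
    apply: cid; have /existsNP[y /not_implyP[Fy ny]] := nF i.
    by exists y; split=> // g Sg gy; apply: ny; exists g.
  pose x i := projT1 (nF i).
  have Fx i : F i (x i) by rewrite /x; case: (nF i) => y [].
  have nx i g : S g -> g i <> x i by rewrite /x; case: (nF i) => y [] /= _; apply.
  apply: (Smax (S `|` [set x])).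
    split=> [g Sg|]; first by left.
    by move=> /(_ x (or_intror erefl)) Sx; exact: (nx i0 x Sx).
  split=> [g [Sg|->] i|g h i [Sg|->] [Sh|->] //]; [exact: SF|exact: Fx|..].
  - exact: Sinj.
  - by move=> e; case: (nx _ _ Sg e).
  - by move=> e; case: (nx _ _ Sh (esym e)).
exists i => j.
have /choice[k kP] : forall y : F i, exists g, S g /\ g i = set_val y.
  by move=> y; have [g] := iF _ (set_valP y); exists g.
pose f (y : F i) : F j := SigSub (mem_set (SF _ (kP y).1 j)).
have finj : {in [set: F i] &, injective f}.
  move=> y z _ _ /(congr1 set_val) /= kyz; apply: val_inj.
  rewrite -[val y](kP y).2 -[val z](kP z).2; congr (_ i).
  exact: Sinj (kP y).1 (kP z).1 kyz.
have [g _] := Pinj finj.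
by apply/card_leP; squash (totalfun_ [set: F i] g).
Qed.

Lemma card_le_total T U (A : set T) (B : set U) : (A #<= B) || (B #<= A).
Proof.
pose C (b : bool) : set (if b then T else U) :=
  if b as b0 return set (if b0 then T else U) then A else B.
have [[] leC] := card_le_min C true.
  by rewrite (leC false).
by rewrite (leC true) orbT.
Qed.

Lemma exists_aleph1 : exists A : set (set nat), ~ countable A /\
  forall T (B : set T), ~ countable B -> A #<= B.
Proof.
pose unc (A : set (set nat)) := ~ countable A.
have uncT : ~ countable [set: set nat].
  move=> /pcard_injP[f finj].
  pose D := [set n | exists2 A, f A = n & ~ A n].
  have fD A : D (f A) <-> ~ A (f A).
    split=> [[B /finj/[!inE]->//]|nA]; last by exists A.
  have [p q] := fD D.
  have nD : ~ D (f D) by move=> Df; exact: (p Df Df).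
  exact: (nD (q nD)).
have [[A uncA] minA] := card_le_min (fun A : {A | unc A} => sval A) (exist unc _ uncT).
exists A; split=> // T B uncB.
have [|leB] := orP (card_le_total [set: set nat] B).
  exact/card_le_trans/card_leT.
have /pcard_leP[f] := leB.
have uncfB : ~ countable (f @` B).
  by rewrite /countable (card_le_eql (card_imsub _ _)).
apply: card_le_trans (minA (exist unc _ uncfB)) _.
exact: card_image_le.
Qed.

(* The Stone-Cech compactification of the discrete space nat, realized as the
   space of ultrafilters; the universal property is [betaN_extension]. *)
Record betaN := BetaN { ultra_of :> set nat -> Prop ; _ : UltraFilter ultra_of }.

#[global] Instance betaN_ultra (U : betaN) : UltraFilter (ultra_of U).
Proof. by case: U. Qed.

HB.instance Definition _ := gen_eqMixin betaN.
HB.instance Definition _ := gen_choiceMixin betaN.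

Lemma betaN_inj (U V : betaN) : ultra_of U = ultra_of V -> U = V.
Proof.
by case: U V => [U hU] [V hV] /= UV; move: UV hU => -> hU; congr BetaN.
Qed.

Lemma betaNC (U : betaN) (A : set nat) : U (~` A) <-> ~ U A.
Proof.
split=> [UnA UA|nUA]; last by have [] := in_ultra_setVsetC A (betaN_ultra U).
by have [n []] := filter_ex (filterI UA UnA).
Qed.

Definition stone (A : set nat) : set betaN := [set U | U A].

Lemma stone_cover : \bigcup_(A in [set: set nat]) stone A = setT.
Proof. by apply/seteqP; split=> // U _; exists setT => //; exact: filterT. Qed.

Lemma stone_join A B (U : betaN) : [set: set nat] A -> [set: set nat] B ->
  stone A U -> stone B U ->
  exists C, [/\ [set: set nat] C, stone C U & stone C `<=` stone A `&` stone B].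
Proof.
move=> _ _ UA UB; exists (A `&` B); split=> //; first exact: filterI.
move=> V; rewrite /stone /= => VAB; split; apply: filterS VAB => n [] //.
Qed.

HB.instance Definition _ := isBaseTopological.Build betaN stone_cover stone_join.

Lemma stone_open A : open (stone A).
Proof. by exists [set A] => //; rewrite bigcup_set1. Qed.

Lemma stone_setC A : stone (~` A) = ~` stone A.
Proof. by apply/seteqP; split=> U /betaNC. Qed.

Lemma stone_closed A : closed (stone A).
Proof. by rewrite -openC -stone_setC; exact: stone_open. Qed.

Lemma nbhs_stone (U : betaN) (O : set betaN) :
  nbhs U O <-> exists2 A, U A & stone A `<=` O.
Proof.
split=> [|[A UA AO]].
  rewrite nbhsE => -[B [[D _ <-] [A DA UA]] BO]; exists A => //.
  by apply: subset_trans BO; exact: bigcup_sup.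
by rewrite nbhsE; exists (stone A) => //; split=> //; exact: stone_open.
Qed.

Lemma betaN_hausdorff : hausdorff_space betaN.
Proof.
move=> U V UV; apply: betaN_inj; apply/esym/max_filter => A UA.
apply: contrapT => /betaNC VnA.
have /UV : nbhs U (stone A) by apply/nbhs_stone; exists A.
have /[swap]/[apply] : nbhs V (stone (~` A)) by apply/nbhs_stone; exists (~` A).
by move=> [W []]; rewrite stone_setC.
Qed.

Lemma betaN_compact : compact [set: betaN].
Proof.
rewrite compact_ultra => G GU _.
pose L : set_system nat := [set A | G (stone A)].
have LF : Filter L.
  split; rewrite /L /=.
  - have -> : stone setT = setT; last exact: filterT.
    by apply/seteqP; split=> // U _; exact: filterT.
  - move=> A B GA GB; apply: (filterS _ (@filterI _ G _ _ _ GA GB)) => U [UA UB].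
    exact: (@filterI _ U _ _ _ UA UB).
  - move=> A B AB GA; apply: (@filterS _ G _ _ _ _ GA) => U UA.
    exact: (@filterS _ U _ _ _ AB UA).
have LP : ProperFilter L.
  split=> //; rewrite /L /= => G0; have [U U0] := @filter_ex _ G _ _ G0.
  by have [] := @filter_ex _ U _ _ U0.
have LU : UltraFilter L.
  split=> // H HP LH; apply/seteqP; split=> [A HA|]; last exact: LH.
  have [//|GnA] := in_ultra_setVsetC (stone A) GU.
  have /LH HnA : L (~` A) by rewrite /L /= stone_setC.
  by have [n []] := @filter_ex _ H _ _ (filterI HA HnA).
exists (BetaN LU); split=> // O /nbhs_stone[A LA AO].
exact: (@filterS _ G _ _ _ AO LA).
Qed.

Definition principal (n : nat) : betaN := BetaN (principal_filter_ultra n).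

Lemma stone_principal n A : stone A (principal n) <-> A n.
Proof. by rewrite /stone /=; split=> /principal_filterP. Qed.

Lemma stone1 n : stone [set n] = [set principal n].
Proof.
apply/seteqP; split=> [U Un|_ ->]; last exact/stone_principal.
apply: betaN_inj; apply/max_filter => A /principal_filterP An.
by apply: (@filterS _ U _ _ _ _ Un) => _ ->.
Qed.

(* [principal] embeds the discrete space of integers as a dense (open) subset,
   and maps into compact Hausdorff spaces extend. *)
Lemma principal_inj : injective principal.
Proof. by move=> m n mn; apply/(stone_principal m [set n]); rewrite mn stone_principal. Qed.

Lemma principal_open n : open [set principal n].
Proof. by rewrite -stone1; exact: stone_open. Qed.

Lemma principal_dense : dense (range principal).
Proof.
move=> O [U OU] oO; have /nbhs_stone[A UA AO] := open_nbhs_nbhs (conj oO OU).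
have [n An] := filter_ex UA; exists (principal n); split; last by exists n.
by apply: AO; apply/stone_principal.
Qed.

Lemma fmap_ultra (T : Type) (f : nat -> T) (U : betaN) :
  UltraFilter (fmap f (ultra_of U : set_system nat)).
Proof.
split=> [|H HP UH]; first exact: fmap_proper_filter.
apply/seteqP; split=> [A HA|]; last exact: UH.
have [//|UnA] := in_ultra_setVsetC (f @^-1` A) (betaN_ultra U).
by have [y []] := @filter_ex _ H _ _ (filterI HA (UH (~` A) UnA)).
Qed.

Lemma betaN_extension (K : topologicalType) (f : nat -> K) :
  compact [set: K] -> hausdorff_space K ->
  exists2 F : betaN -> K, continuous F & forall n, F (principal n) = f n.
Proof.
move=> cK hK.
pose G (U : betaN) : set_system K := f @ (ultra_of U : set_system nat).
have GP U : ProperFilter (G U) by exact: fmap_proper_filter.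
have cvgf U : {x : K | G U --> x}.
  apply: cid; move: cK; rewrite compact_ultra => /(_ (G U) _ filterT).
  case=> [|x [_ fx]]; last by exists x.
  exact: fmap_ultra.
pose F U := projT1 (cvgf U).
have cvgF U : G U --> F U by exact: projT2 (cvgf U).
exists F => [U O|n]; last first.
  apply: (hK) => A B /cvgF /principal_filterP fA /nbhs_singleton fB.
  by exists (f n).
move=> /(compact_regular hK cK filterT)[B UB BO].
apply/nbhs_stone; exists (f @^-1` B) => [|V VB /=]; first exact: cvgF UB.
apply: BO => C VC; have [n []] := @filter_ex _ V _ _ (@filterI _ V _ _ _ VB (cvgF V _ VC)).
by exists (f n).
Qed.

Definition Nstar : set betaN := ~` range principal.

Lemma Nstar_closed : closed Nstar.
Proof.
rewrite closedC (_ : range _ = \bigcup_n [set principal n]).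
  by apply: bigcup_open => n _; exact: principal_open.
by apply/seteqP; split=> [_ [n _ <-]|_ [n _ ->]]; exists n.
Qed.

Lemma set_type_compact (X : topologicalType) (A : set X) :
  compact A -> compact [set: A].
Proof.
move=> cA F FF _.
have [|p [Ap Fp]] := cA (set_val @ F) _.
  by apply: (@filterS _ F _ setT) filterT => x _; exact: set_valP.
exists (SigSub (mem_set Ap)); split=> // P O FP [_ [[W oW <-] Wp WO]].
have FP' : (set_val @ F) (set_val @` P).
  by apply: (@filterS _ F _ P) FP => x Px; exists x.
have pW : nbhs p W by exact: open_nbhs_nbhs.
have [_ [[x Px <-] Wx]] := Fp _ _ FP' pW.
by exists x; split=> //; exact: WO.
Qed.

Lemma Nstar_compact : compact [set: Nstar].
Proof.
apply: set_type_compact.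
exact: subclosed_compact Nstar_closed betaN_compact _.
Qed.

Definition Cspace (R : realType) (K : topologicalType)
  of compact [set: K] := continuousType K R.

Section Cspace.
Variables (R : realType) (K : topologicalType) (cK : compact [set: K]).
Local Notation C := (@Cspace R K cK).
Implicit Types f g h : C.

HB.instance Definition _ := Choice.on C.

Definition Cfun f : K -> R := f.

Lemma Cspace_continuous f : continuous (Cfun f).
Proof. exact: cts_fun. Qed.

Lemma CspaceP f g : Cfun f =1 Cfun g -> f = g.
Proof. by move=> fg; apply/continuousEP. Qed.

Definition mkC (f : K -> R) (cf : continuous f) : C := mkcts cf.

Lemma Cspace_add_subproof f g : continuous (Cfun f \+ Cfun g).
Proof. by move=> x; apply: cvgD; exact: Cspace_continuous. Qed.

Lemma Cspace_opp_subproof f : continuous (\- Cfun f).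
Proof. by move=> x; apply: cvgN; exact: Cspace_continuous. Qed.

Lemma Cspace_scale_subproof (a : R) f : continuous (a \*: Cfun f).
Proof. by move=> x; apply: cvgZr; exact: Cspace_continuous. Qed.

Lemma Cspace_zero_subproof : continuous (fun _ : K => 0 : R).
Proof. by move=> x; exact: cvg_cst. Qed.

Definition Cspace_add f g := mkC (@Cspace_add_subproof f g).
Definition Cspace_opp f := mkC (@Cspace_opp_subproof f).
Definition Cspace_scale (a : R) f := mkC (@Cspace_scale_subproof a f).
Definition Cspace_zero := mkC Cspace_zero_subproof.

Lemma Cspace_addA : associative Cspace_add.
Proof. by move=> f g h; apply: CspaceP => x; exact: addrA. Qed.
Lemma Cspace_addC : commutative Cspace_add.
Proof. by move=> f g; apply: CspaceP => x; exact: addrC. Qed.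
Lemma Cspace_add0 : left_id Cspace_zero Cspace_add.
Proof. by move=> f; apply: CspaceP => x; exact: add0r. Qed.
Lemma Cspace_addN : left_inverse Cspace_zero Cspace_opp Cspace_add.
Proof. by move=> f; apply: CspaceP => x; exact: addNr. Qed.

HB.instance Definition _ := GRing.isZmodule.Build C
  Cspace_addA Cspace_addC Cspace_add0 Cspace_addN.

Lemma Cspace_scaleA a b f :
  Cspace_scale a (Cspace_scale b f) = Cspace_scale (a * b) f.
Proof. by apply: CspaceP => x; exact: mulrA. Qed.
Lemma Cspace_scale1 : left_id 1 Cspace_scale.
Proof. by move=> f; apply: CspaceP => x; exact: mul1r. Qed.
Lemma Cspace_scaleDr : right_distributive Cspace_scale +%R.
Proof. by move=> a f g; apply: CspaceP => x; exact: mulrDr. Qed.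
Lemma Cspace_scaleDl f : {morph Cspace_scale^~ f : a b / a + b}.
Proof. by move=> a b; apply: CspaceP => x; exact: mulrDl. Qed.

HB.instance Definition _ := GRing.Zmodule_isLmodule.Build R C
  Cspace_scaleA Cspace_scale1 Cspace_scaleDr Cspace_scaleDl.

Definition Cspace_norm f : R := sup [set `|Cfun f x| | x in [set: K]].

Lemma Cspace_norm_ge f x : `|Cfun f x| <= Cspace_norm f.
Proof.
apply: ub_le_sup; last by exists x.
have /compact_bounded[M [_ fM]] : compact (Cfun f @` [set: K]).
  apply: continuous_compact cK.
  exact/continuous_subspaceT/Cspace_continuous.
by exists (M + 1) => _ [y _ <-]; apply: (fM (M + 1)); [rewrite ltrDl|exists y].
Qed.

Lemma Cspace_norm_ge0 f : 0 <= Cspace_norm f.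
Proof.
have [K0|/set0P[x _]] := eqVneq [set: K] set0.
  by rewrite /Cspace_norm K0 image_set0 sup0.
exact: le_trans (Cspace_norm_ge f x).
Qed.

Lemma Cspace_norm_le f r : 0 <= r -> (forall x, `|Cfun f x| <= r) ->
  Cspace_norm f <= r.
Proof.
move=> r0 fr; have [K0|/set0P[x _]] := eqVneq [set: K] set0.
  by rewrite /Cspace_norm K0 image_set0 sup0.
by apply: ge_sup => [|_ [y _ <-] //]; exists `|Cfun f x|, x.
Qed.

Lemma Cspace_normD f g : Cspace_norm (f + g) <= Cspace_norm f + Cspace_norm g.
Proof.
apply: Cspace_norm_le => [|x]; first by rewrite addr_ge0 ?Cspace_norm_ge0.
apply: le_trans (ler_normD (Cfun f x) (Cfun g x)) _.
by apply: lerD; exact: Cspace_norm_ge.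
Qed.

Lemma Cspace_normZ a f : Cspace_norm (a *: f) = `|a| * Cspace_norm f.
Proof.
have le b h : Cspace_norm (b *: h) <= `|b| * Cspace_norm h.
  apply: Cspace_norm_le => [|x]; first by rewrite mulr_ge0 ?Cspace_norm_ge0.
  by rewrite [Cfun _ x]/(b * Cfun h x) normrM ler_wpM2l ?Cspace_norm_ge.
apply/le_anti; rewrite le /=.
have [->|a0] := eqVneq a 0; first by rewrite normr0 mul0r Cspace_norm_ge0.
rewrite -ler_pdivlMl ?normr_gt0// -normfV.
by apply: le_trans (le _ _); rewrite scalerA mulVf// scale1r.
Qed.

Lemma Cspace_norm0 f : Cspace_norm f = 0 -> f = 0.
Proof.
move=> f0; apply: CspaceP => x; apply/eqP; rewrite -normr_le0 -f0.
exact: Cspace_norm_ge.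
Qed.

HB.instance Definition _ := Lmodule_isNormed.Build R C
  Cspace_normD Cspace_normZ Cspace_norm0.

Lemma Cspace_complete (F : set_system C) : ProperFilter F -> cauchy F -> cvg F.
Proof.
move=> FF /cauchyP Fc.
have {}Fc e : 0 < e -> exists f0 : C, F [set f | `|f0 - f| < e].
  by move=> /Fc[f0]; rewrite -ball_normE; exists f0.
have Fpt x : cauchy ((fun f => Cfun f x) @ F).
  apply: cauchy_exP => e /Fc[f0 Ff0]; exists (Cfun f0 x).
  apply: (@filterS _ F _ _ _ _ Ff0) => f /=; rewrite -ball_normE /=.
  exact/le_lt_trans/(Cspace_norm_ge (f0 - f) x).
pose g x : R := lim ((fun f => Cfun f x) @ F).
have gF e : 0 < e ->
    exists2 f0 : C, F [set f | `|f0 - f| < e] & forall x, `|g x - Cfun f0 x| <= e.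
  move=> /Fc[f0 Ff0]; exists f0 => // x.
  have cx : (fun f => Cfun f x) @ F --> g x by apply: cauchy_cvg (Fpt x).
  apply/ler_addgt0Pr => d d0; have [f []] := filter_ex
    (filterI Ff0 ((@cvgrPdist_le _ _ _ F _ _ _).1 cx d d0)).
  move=> /= f0f gf.
  rewrite [leRHS]addrC -(subrKA (Cfun f x)) (le_trans (ler_normD _ _))//.
  apply: lerD => //; rewrite distrC.
  exact/le_trans/(ltW f0f)/(Cspace_norm_ge (f0 - f) x).
have cg : continuous g.
  move=> x; apply/cvgrPdist_le => e e0.
  have e3 : 0 < e / 3 by rewrite divr_gt0.
  have [f0 _ gf0] := gF _ e3.
  have cf0 := (@cvgrPdist_le _ _ _ (nbhs x) (nbhs_filter x) _ _).1 (@Cspace_continuous f0 x) _ e3.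
  apply: (@filterS _ (nbhs x) (nbhs_filter x) _ _ _ cf0) => y /= f0xy.
  have -> : g x - g y =
      (g x - Cfun f0 x) + (Cfun f0 x - Cfun f0 y) + (Cfun f0 y - g y) by ring.
  have -> : e = e / 3 + e / 3 + e / 3 by field.
  apply: le_trans (ler_normD _ _) _; apply: lerD; last by rewrite distrC.
  by apply: le_trans (ler_normD _ _) _; exact: lerD.
apply/cvg_ex; exists (mkC cg); apply/cvgrPdist_le => e e0.
have e2 : 0 < e / 2 by rewrite divr_gt0.
have [f0 Ff0 gf0] := gF _ e2.
apply: (@filterS _ F _ _ _ _ Ff0) => f /= f0f.
rewrite -(subrKA f0) (le_trans (ler_normD _ _))// [leRHS](splitr e).
apply: lerD; last exact: ltW.
by apply: Cspace_norm_le => [|x]; [exact: ltW|exact: gf0].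
Qed.

HB.instance Definition _ := Uniform_isComplete.Build C Cspace_complete.

End Cspace.

Lemma exists_dens (X : topologicalType) :
  exists D : set X, dense D /\ forall D' : set X, dense D' -> D #<= D'.
Proof.
have dT : dense [set: X] by move=> O O0 _; rewrite setIT.
have [[D dD] minD] := card_le_min
  (fun D : {D : set X | @dense X D} => sval D) (exist (@dense X) _ dT).
by exists D; split=> // D' dD'; exact: (minD (exist (@dense X) D' dD')).
Qed.

(* A dense subset of least cardinality; only its cardinality is meaningful. *)
Definition dens (X : topologicalType) : set X := projT1 (cid (exists_dens X)).
Arguments dens : clear implicits.

Lemma densP (X : topologicalType) :
  dense (dens X) /\ forall D : set X, dense D -> dens X #<= D.
Proof. exact: projT2 (cid (exists_dens X)). Qed.

Definition aleph1 : set (set nat) := projT1 (cid exists_aleph1).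

Lemma aleph1P : ~ countable aleph1 /\
  forall T (B : set T), ~ countable B -> aleph1 #<= B.
Proof. exact: projT2 (cid exists_aleph1). Qed.

Lemma card_lt_aleph1 T (B : set T) : card_lt B aleph1 <-> countable B.
Proof.
have [unc min1] := aleph1P; split=> [/andP[_ nle]|cB].
  by apply: contrapT => /min1; exact/negP.
have nle : ~~ (aleph1 #<= B).
  by apply/negP => /card_le_trans /(_ cB).
by rewrite /card_lt nle andbT; have := card_le_total B aleph1; rewrite (negbTE nle) orbF.
Qed.

Section operators.
Variables (R : realType) (X E : normedModType R).

Definition is_subspace (Y : set X) :=
  [/\ closed Y, Y 0 & forall (a : R) x y, Y x -> Y y -> Y (a *: x + y)].

(* An operator from the subspace [Y] to [E] is given by the restriction to [Y] of
   a function on [X]; its values outside of [Y] are irrelevant. *)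
Definition is_operator (Y : set X) (t : X -> E) :=
  (forall (a : R) x y, Y x -> Y y -> t (a *: x + y) = a *: t x + t y) /\
  exists M : R, forall x, Y x -> `|t x| <= M * `|x|.

Definition opnorm (Y : set X) (t : X -> E) : R :=
  sup [set `|t x| | x in [set x | Y x /\ `|x| <= 1]].

Lemma opnormP (Y : set X) (t : X -> E) : is_subspace Y -> is_operator Y t ->
  forall x, Y x -> `|t x| <= opnorm Y t * `|x|.
Proof.
move=> [_ Y0 Yl] [tl [M tM]] x Yx.
have YZ a : Y (a *: x) by rewrite -[_ *: _]addr0; exact: Yl.
have t0 : t 0 = 0.
  by have := tl 1 0 0 Y0 Y0; rewrite !scale1r addr0 => /eqP; rewrite addrC -subr_eq subrr eq_sym => /eqP.
have tZ a : t (a *: x) = a *: t x by rewrite -[a *: x]addr0 tl// t0 addr0.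
have [->|x0] := eqVneq x 0; first by rewrite t0 !normr0 mulr0.
rewrite -ler_pdivrMr ?normr_gt0//; apply: ub_le_sup.
  exists `|M| => _ [y [Yy y1] <-]; apply: le_trans (tM _ Yy) _.
  apply: (le_trans (ler_wpM2r (normr_ge0 y) (ler_norm M))).
  by rewrite -[leRHS]mulr1 ler_wpM2l.
exists (`|x|^-1 *: x); last by rewrite tZ normrZ normfV normr_id mulrC.
by split=> //; rewrite normrZ normfV normr_id mulVf// normr_eq0.
Qed.

End operators.

(* [E] is (1, aleph)-injective; a cardinal is represented by any set having it. *)
Definition one_injective (R : realType) (A : Type) (aleph : set A)
    (E : completeNormedModType R) :=
  forall (X : completeNormedModType R), card_lt (dens X) aleph ->
  forall Y : set X, is_subspace Y -> forall t : X -> E, is_operator Y t ->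
  exists T : X -> E,
    [/\ is_operator setT T, forall y, Y y -> T y = t y
      & opnorm setT T <= opnorm Y t].

Definition CNstar (R : realType) : completeNormedModType R :=
  Cspace R Nstar_compact.

Section quotient.
Variable R : realType.
Implicit Types u v : nat -> R.

Definition linf : set (nat -> R) := [set u | exists M, forall n, `|u n| <= M].
Definition c0 : set (nat -> R) := [set u | u @ \oo --> 0].

Lemma Nstar_infinite (U : Nstar) n : set_val U (~` [set n]).
Proof.
apply/betaNC => Un; apply: (set_valP U).
by exists n => //; apply/esym; have : stone [set n] (set_val U) by []; rewrite stone1.
Qed.

Lemma Nstar_cofinite (U : Nstar) N : set_val U [set n | (N <= n)%N].
Proof.
elim: N => [|N IH]; first by apply: (@filterS _ (set_val U) _ setT) filterT => n _.
apply: (@filterS _ (set_val U) _ _ _ _ (@filterI _ (set_val U) _ _ _ IH (Nstar_infinite U N))).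
by move=> n [/= Nn nN]; rewrite ltn_neqAle Nn andbT; apply/eqP => e; exact: nN.
Qed.

Lemma Nstar_ex (A : set nat) : (forall N, exists2 n, A n & (N <= n)%N) ->
  exists U : Nstar, set_val U A.
Proof.
move=> Ainf.
have FF : ProperFilter (filter_from setT (fun N : nat => A `&` [set n | (N <= n)%N])).
  apply: filter_from_proper => [|N _]; last by have [n] := Ainf N; exists n.
  apply: filter_from_filter => [|i j _ _]; first by exists 0%N.
  exists (maxn i j) => // n [An /=]; rewrite geq_max => /andP[? ?]; by split; split.
have [G [GU FG]] := ultraFilterLemma FF.
have GN : Nstar (BetaN GU).
  move=> [n _ /(congr1 ultra_of) /= e].
  have Gn : G [set n] by rewrite -e; apply/principal_filterP.
  have GnN : G (A `&` [set m | (n.+1 <= m)%N]) by apply: FG; exists n.+1.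
  have [m [-> []]] := @filter_ex _ G _ _ (filterI Gn GnN).
  by rewrite /= ltnn.
exists (SigSub (mem_set GN)) => /=.
by apply: (FG); exists 0%N => // n [].
Qed.

Lemma ulim_subproof u (U : betaN) : {l : R | linf u ->
  forall e, 0 < e -> U [set n | `|l - u n| <= e]}.
Proof.
apply: cid; have [[M uM]|?] := pselect (linf u); last by exists 0.
have := @segment_compact R (- M) M; rewrite compact_ultra.
move=> /(_ _ (fmap_ultra u U))[|l [_ ul]].
  by apply: (@filterS _ U _ setT _ _ filterT) => n _; rewrite /= in_itv/= -ler_norml.
by exists l => _ e e0; exact: ((@cvgrPdist_le _ _ _ U _ u l).1 ul).
Qed.

Definition ulim u (U : betaN) : R := projT1 (ulim_subproof u U).

Lemma ulimP u (U : betaN) : linf u ->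
  forall e, 0 < e -> U [set n | `|ulim u U - u n| <= e].
Proof. exact: projT2 (ulim_subproof u U). Qed.

Lemma ulim_unique u (U : betaN) l : linf u ->
  (forall e, 0 < e -> U [set n | `|l - u n| <= e]) -> ulim u U = l.
Proof.
move=> ub ul; apply/eqP; rewrite -subr_eq0 -normr_le0; apply/ler_addgt0Pr => e e0.
have e2 : 0 < e / 2 by rewrite divr_gt0.
have [n [/= a b]] := @filter_ex _ U _ _ (@filterI _ U _ _ _ (ulimP U ub e2) (ul _ e2)).
rewrite add0r -(subrKA (u n)) (le_trans (ler_normD _ _))// (splitr e) lerD//.
by rewrite distrC.
Qed.

Lemma ulim_continuous u : linf u -> continuous (ulim u).
Proof.
move=> ub U; apply/(@cvgrPdist_le _ _ _ (nbhs U) (nbhs_filter U)) => e e0.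
have e2 : 0 < e / 2 by rewrite divr_gt0.
apply/nbhs_stone; exists [set n | `|ulim u U - u n| <= e / 2]; first exact: ulimP.
move=> V VA /=.
have [n [/= a b]] := @filter_ex _ V _ _ (@filterI _ V _ _ _ VA (ulimP V ub e2)).
rewrite -(subrKA (u n)) (le_trans (ler_normD _ _))// (splitr e) lerD//.
by rewrite distrC.
Qed.

Lemma qmap_subproof u : {f : CNstar R | linf u ->
  forall U : Nstar, Cfun f U = ulim u (set_val U)}.
Proof.
apply: cid; have [ub|?] := pselect (linf u); last by exists 0.
have cu : continuous (fun U : Nstar => ulim u (set_val U)).
  move=> U; apply: (@continuous_comp _ _ _ set_val (ulim u)).
    exact: initial_continuous.
  exact: ulim_continuous.
by exists (mkC Nstar_compact cu).
Qed.

Definition qmap u : CNstar R := projT1 (qmap_subproof u).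

Lemma qmapE u (U : Nstar) : linf u -> Cfun (qmap u) U = ulim u (set_val U).
Proof. by move=> ub; exact: projT2 (qmap_subproof u) ub U. Qed.

Lemma linf_lin (a : R) u v : linf u -> linf v -> linf (a *: u + v).
Proof.
move=> [M uM] [N vN]; exists (`|a| * M + N) => n.
rewrite (le_trans (ler_normD _ _))// lerD// normrM.
by rewrite ler_wpM2l.
Qed.

Lemma qmap_lin (a : R) u v : linf u -> linf v ->
  qmap (a *: u + v) = a *: qmap u + qmap v.
Proof.
move=> ub vb; apply: CspaceP => U.
rewrite [RHS]/(a * Cfun (qmap u) U + Cfun (qmap v) U).
rewrite !qmapE//; last exact: linf_lin.
apply: ulim_unique => [|e e0]; first exact: linf_lin.
pose d := e / (`|a| + 1).
have a1 : 0 < `|a| + 1 by rewrite ltr_wpDl.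
have d0 : 0 < d by rewrite divr_gt0.
pose W := ultra_of (set_val U).
apply: (@filterS _ W _ _ _ _ (@filterI _ W _ _ _ (ulimP _ ub d0) (ulimP _ vb d0))).
move=> n [/= x y].
have -> : a * ulim u (val U) + ulim v (val U) - (a * u n + v n) =
  a * (ulim u (val U) - u n) + (ulim v (val U) - v n) by ring.
rewrite (le_trans (ler_normD _ _))// normrM.
have -> : e = `|a| * d + d by rewrite /d; field; rewrite gt_eqF.
by rewrite lerD// ler_wpM2l.
Qed.

Lemma valL_Cfun (f : CNstar R) (U : Nstar) :
  valL_ 0 (Cfun f) (set_val U) = Cfun f U.
Proof. by have /(congr1 (@^~ U)) := @valLK _ _ (0 : R) Nstar (Cfun f). Qed.

Lemma qmap_surj (f : CNstar R) : exists2 u, linf u & qmap u = f.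
Proof.
have ngt0 : 0 < `|f| + 1 by rewrite ltr_wpDl.
have [] := @continuous_bounded_extension betaN R
  (compact_normal betaN_hausdorff betaN_compact) Nstar Nstar_closed
  (valL_ 0 (Cfun f)) (`|f| + 1) ngt0.
- exact/subspace_valL_continuousP'/Cspace_continuous.
- move=> U NU; rewrite (valL_Cfun f (SigSub (mem_set NU))).
  by apply: le_trans (Cspace_norm_ge f _) _; rewrite lerDl.
move=> g [gf cg gM].
have ub : linf (g \o principal) by exists (`|f| + 1) => n; exact: gM.
exists (g \o principal) => //; apply: CspaceP => U; rewrite qmapE//.
apply: ulim_unique => // e e0.
have := (@cvgrPdist_le _ _ _ _ (nbhs_filter (set_val U)) _ _).1 (cg (set_val U)) e e0.
move=> /nbhs_stone[A UA Ag].
apply: (@filterS _ (set_val U) _ _ _ _ UA) => n An.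
have /= := Ag (principal n) ((stone_principal n A).2 An).
by rewrite -(gf (set_val U) (mem_set (set_valP U))) valL_Cfun.
Qed.

Lemma qmap_norm u : linf u ->
  `|qmap u| = inf [set sup [set `|u n - v n| | n in [set: nat]] | v in c0].
Proof.
move=> ub; set S := [set _ | v in c0].
have supP v n : linf v -> `|u n - v n| <= sup [set `|u n - v n| | n in [set: nat]].
  move=> [N vN]; have [M uM] := ub; apply: ub_le_sup; last by exists n.
  by exists (M + N) => _ [m _ <-]; rewrite (le_trans (ler_normB _ _))// lerD.
have c0b v : c0 v -> linf v.
  move=> v0; have /cvg_seq_bounded[M [_ vM]] : cvgn v by apply: cvgP v0.
  by exists (M + 1) => n; apply: (vM (M + 1)); rewrite ?ltrDl.
have c00 : c0 (fun=> 0) by exact: cvg_cst.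
apply/le_anti/andP; split.
  apply: lb_le_inf => [|_ [v v0 <-]]; first by exists (sup [set `|u n - 0| | n in [set: nat]]), (fun=> 0).
  apply: Cspace_norm_le => [|U].
    exact: le_trans (normr_ge0 _) (supP v 0%N (c0b v v0)).
  rewrite qmapE//; apply/ler_addgt0Pr => e e0.
  have e2 : 0 < e / 2 by rewrite divr_gt0.
  have [N _ vN] := (@cvgrPdist_le _ _ _ _ eventually_filter v 0).1 v0 _ e2.
  pose W := ultra_of (set_val U).
  have [n [/= a /vN/=]] := @filter_ex _ W _ _ (@filterI _ W _ _ _ (ulimP _ ub e2) (Nstar_cofinite U N)).
  rewrite sub0r normrN => b.
  have -> : ulim u (val U) = (u n - v n) + ((ulim u (val U) - u n) + v n) by ring.
  apply: le_trans (ler_normD _ _) _; apply: lerD.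
    by apply: supP; exact: c0b.
  by rewrite (le_trans (ler_normD _ _))// (splitr e) lerD.
apply/ler_addgt0Pr => e e0.
pose v n := if `|u n| <= `|qmap u| + e then 0 else u n.
have v0 : c0 v.
  have [N vN] : exists N, forall n, (N <= n)%N -> v n = 0.
    apply: contrapT => /forallNP nN.
    have [N|U UA] := @Nstar_ex [set n | `|qmap u| + e < `|u n|].
      have /existsNP[n /not_implyP[Nn vn]] := nN N; exists n => //=.
      by rewrite ltNge; apply/negP => un; apply: vn; rewrite /v un.
    have e2 : 0 < e / 2 by rewrite divr_gt0.
    pose W := ultra_of (set_val U).
    have [n [/= a b]] := @filter_ex _ W _ _ (@filterI _ W _ _ _ (ulimP _ ub e2) UA).
    move: b; rewrite ltNge => /negP; apply.
    have -> : u n = ulim u (val U) - (ulim u (val U) - u n) by ring.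
    rewrite (le_trans (ler_normB _ _))// lerD//.
      by rewrite -qmapE//; exact: Cspace_norm_ge.
    by rewrite (le_trans a)// ler_pdivrMr// ler_pMr// ler1n.
  apply: cvg_near_cst; exists N => // n /= Nn; exact: vN.
have S0 : lbound S 0.
  move=> _ [w w0 <-]; exact: le_trans (normr_ge0 _) (supP w 0%N (c0b w w0)).
apply: (@le_trans _ _ (sup [set `|u n - v n| | n in [set: nat]])).
  by apply: ge_inf; [exists 0|exists v].
apply: ge_sup => [|_ [n _ <-]]; first by exists `|u 0%N - v 0%N|, 0%N.
rewrite /v; case: ifPn => [un|_]; first by rewrite subr0.
by rewrite subrr normr0 addr_ge0// ltW.
Qed.

(* C(N^* ) is isometrically isomorphic to l_infty / c_0: the right-hand side of the
   last equation is the quotient norm of the class of [u]. *)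
Lemma CNstar_linf_c0 : exists q : (nat -> R) -> CNstar R,
  [/\ forall a u v, linf u -> linf v -> q (a *: u + v) = a *: q u + q v,
      forall f, exists2 u, linf u & q u = f
    & forall u, linf u ->
      `|q u| = inf [set sup [set `|u n - v n| | n in [set: nat]] | v in c0]].
Proof.
exists qmap; split; [exact: qmap_lin|exact: qmap_surj|exact: qmap_norm].
Qed.

End quotient.

(* Main.v *)
(** Since [l_infty / c_0] is the quotient by the null sequences, a diagonal
    argument gives it the countable ball intersection property: countably many
    closed balls [B(f_i, r_i)] with [|f_i - f_j| <= r_i + r_j] have a common
    point.  Extending an operator [t] from [Y] to [Y + R x] with the bound [M]
    amounts to finding a common point of the balls [B(t y, M |y - x|)], and by
    continuity it suffices to let [y] run through a countable dense subset of
    [Y].  Zorn's lemma then extends [t] to the whole separable space. *)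
Require Import Defs.
From mathcomp Require Import all_boot all_order all_algebra.
From mathcomp Require Import ring lra.
From mathcomp Require Import all_classical all_reals all_analysis.
Import Order.TTheory GRing.Theory Num.Theory.
Import numFieldNormedType.Exports.

Set Implicit Arguments.
Unset Strict Implicit.
Unset Printing Implicit Defensive.

Local Open Scope classical_set_scope.
Local Open Scope ring_scope.

Lemma invS_lt (R : realType) (e : R) : 0 < e ->
  exists k : nat, k.+1%:R^-1 < e.
Proof.
by move=> e0; have [k _ /(_ k (leqnn k))] := near_infty_natSinv_lt (PosNum e0); exists k.
Qed.

(** * Ball intersection in [CNstar] *)

Definition ball_intersection (R : realType) (E : normedModType R) :=
  forall (f : nat -> E) (r : nat -> R),
  (forall i j, `|f i - f j| <= r i + r j) ->
  exists h, forall i, `|h - f i| <= r i.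

Section CNstar_ball_intersection.
Variable R : realType.
Implicit Types (u : nat -> R) (x r : nat -> R).

(** The norm of a class is the limit superior of the moduli: infinitely many large terms are caught
    by some free ultrafilter, and every free ultrafilter contains all tails. *)
Lemma qmap_norm_leP u (c : R) : linf u ->
  `|qmap u| <= c <->
  (0 <= c /\ forall e, 0 < e -> exists N, forall n, (N <= n)%N -> `|u n| <= c + e).
Proof.
move=> ub; split=> [uc|[c0 uc]].
  split=> [|e e0]; first exact: le_trans (normr_ge0 _) uc.
  apply: contrapT => /forallNP nN.
  have [N|U UA] := @Nstar_ex [set n | c + e < `|u n|].
    have /existsNP[n /not_implyP[Nn un]] := nN N; exists n => //=.
    by rewrite ltNge; exact/negP.
  have e2 : 0 < e / 2 by rewrite divr_gt0.
  have [n [/= a b]] :=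
    @filter_ex _ (set_val U) _ _ (@filterI _ (set_val U) _ _ _ (ulimP _ ub e2) UA).
  have := Cspace_norm_ge (qmap u) U; rewrite qmapE// => qn.
  have := ler_normB (ulim u (val U)) (ulim u (val U) - u n).
  rewrite subKr => tri.
  have := le_trans qn uc; lra.
apply: Cspace_norm_le => // U; rewrite qmapE//; apply/ler_addgt0Pr => e e0.
have e2 : 0 < e / 2 by rewrite divr_gt0.
have [N uN] := uc _ e2.
have [n [/= a /uN b]] := @filter_ex _ (set_val U) _ _
  (@filterI _ (set_val U) _ _ _ (ulimP _ ub e2) (Nstar_cofinite U N)).
have := ler_normD (ulim u (val U) - u n) (u n).
rewrite subrK => tri; lra.
Qed.

Lemma qmapB u v : linf u -> linf v -> qmap (u - v) = qmap u - qmap v.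
Proof.
move=> ub vb; rewrite -scaleN1r addrC qmap_lin//.
by rewrite scaleN1r addrC.
Qed.

Lemma linfB u v : linf u -> linf v -> linf (u - v).
Proof. by move=> ub vb; rewrite -scaleN1r addrC; exact: linf_lin. Qed.

(* [z] is built from the largest [k <= n] satisfying the hypothesis; it will be
   applied to the [n]-th terms of a family of sequences, so that this [k] tends
   to infinity with [n]. *)
Lemma diagonal_point x r (n : nat) : 0 <= r 0%N -> exists z : R,
  forall k, (k <= n)%N ->
  (forall i j, (i <= k)%N -> (j <= k)%N -> `|x i - x j| <= r i + r j + k.+1%:R^-1) ->
  forall i, (i <= k)%N -> `|z - x i| <= r i + k.+1%:R^-1.
Proof.
move=> r0.
pose P k := `[< (k <= n)%N /\ forall i j, (i <= k)%N -> (j <= k)%N ->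
  `|x i - x j| <= r i + r j + k.+1%:R^-1 >].
have exP : exists k, P k.
  exists 0%N; apply/asboolP; split=> // i j; rewrite !leqn0 => /eqP-> /eqP->.
  by rewrite subrr normr0 invr1; lra.
have Pn k : P k -> (k <= n)%N by move=> /asboolP[].
case: (ex_maxnP exP Pn) => K /asboolP[_ xK] maxK.
(* Helly on the line: the intervals of centre [x i] and radius [r i] meet pairwise up to an error,
   so the largest left endpoint lies below every right endpoint up to that error. *)
exists (\big[Order.max/x 0%N - r 0%N]_(i < K.+1) (x i - r i)) => k kn xk i ik.
have kK : (k <= K)%N by apply: maxK; exact/asboolP.
have iK : (i < K.+1)%N by rewrite ltnS (leq_trans ik).
have lek : K.+1%:R^-1 <= k.+1%:R^-1 :> R by rewrite lef_pV2 ?posrE// ler_nat.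
have k0 : 0 < k.+1%:R^-1 :> R by rewrite invr_gt0.
have up : \big[Order.max/x 0%N - r 0%N]_(i < K.+1) (x i - r i)
    <= x i + r i + k.+1%:R^-1.
  have aux (j : nat) : (j <= K)%N -> x j - r j <= x i + r i + k.+1%:R^-1.
    move=> jK; have := le_trans (ler_norm _) (xK j i jK iK).
    by move: K.+1%:R^-1 k.+1%:R^-1 lek {k0} => a b; lra.
  by apply: bigmax_le => [|j _]; apply: aux => //; rewrite -ltnS.
have low := le_bigmax_cond (x 0%N - r 0%N)
  (fun i : 'I_K.+1 => x i - r i) (erefl : xpredT (Ordinal iK)).
rewrite /= in low; rewrite ler_norml; apply/andP; move: low up k0.
by move: (bigop _ _ _) k.+1%:R^-1 => z c; split; lra.
Qed.

Lemma eventually_forall_ltn (k : nat) (Q : nat -> nat -> Prop) :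
  (forall i, exists N, forall n, (N <= n)%N -> Q i n) ->
  exists N, forall n, (N <= n)%N -> forall i, (i < k)%N -> Q i n.
Proof.
move=> QN; elim: k => [|k [N IH]]; first by exists 0%N.
have [N' Q'] := QN k; exists (maxn N N') => n; rewrite geq_max => /andP[Nn N'n] i.
by rewrite ltnS leq_eqVlt => /orP[/eqP->|]; [exact: Q'|exact: IH].
Qed.

Lemma CNstar_ball_intersection : ball_intersection (CNstar R).
Proof.
move=> f r fr.
have r0 i : 0 <= r i by have := fr i i; rewrite subrr normr0; lra.
have /choice[u uP] i : exists u, linf u /\ qmap u = f i.
  by have [u] := qmap_surj (f i); exists u.
have ub i := (uP i).1.
have /choice[h hP] := fun n => diagonal_point (fun i => u i n) n (r0 0%N).
(* The hypothesis of [hP] always holds for [k = 0], so [h n] stays within [r 0 + 1] of the bounded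
   sequence [u 0]. *)
have hb : linf h.
  have [M uM] := ub 0%N; exists (M + r 0%N + 1) => n.
  have := hP n 0%N (leq0n n); rewrite invr1 => /(_ _ 0%N (leqnn 0)) H.
  have {}H : `|h n - u 0%N n| <= r 0%N + 1.
    apply: H => i j; rewrite !leqn0 => /eqP-> /eqP->.
    by rewrite subrr normr0; have := r0 0%N; lra.
  have := ler_normD (h n - u 0%N n) (u 0%N n); rewrite subrK.
  by have := uM n; lra.
exists (qmap h) => i; rewrite -(uP i).2 -qmapB//.
apply/(qmap_norm_leP _ (linfB hb (ub i))); split=> // e e0.
have [k0 k0e] := invS_lt e0.
(* Large enough for the error to be below [e] and for the ball [i] to be among those treated. *)
pose k := maxn k0 i.
have ke : k.+1%:R^-1 < e.
  by apply: le_lt_trans k0e; rewrite lef_pV2 ?posrE// ler_nat ltnS leq_maxl.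
have kgt0 : 0 < k.+1%:R^-1 :> R by rewrite invr_gt0.
(* Only finitely many pairs of indices are involved, so one threshold serves them all. *)
have [N uN] : exists N, forall n, (N <= n)%N -> forall i, (i < k.+1)%N ->
    forall j, (j < k.+1)%N -> `|u i n - u j n| <= r i + r j + k.+1%:R^-1.
  apply: (@eventually_forall_ltn k.+1 (fun i n => forall j, (j < k.+1)%N ->
    `|u i n - u j n| <= r i + r j + k.+1%:R^-1)) => i'.
  apply: (@eventually_forall_ltn k.+1
    (fun j n => `|u i' n - u j n| <= r i' + r j + k.+1%:R^-1)) => j.
  have := fr i' j; rewrite -(uP i').2 -(uP j).2 -qmapB//.
  by move=> /(qmap_norm_leP _ (linfB (ub i') (ub j)))[_ /(_ _ kgt0)].
exists (maxn N k) => n; rewrite geq_max => /andP[Nn kn].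
have := hP n k kn (fun i j ik jk => uN n Nn i ik j jk) i (leq_maxr _ _).
by move=> H; apply: le_trans H _; rewrite lerD2l ltW.
Qed.

End CNstar_ball_intersection.

(** * Extension of bounded operators on separable spaces *)

Lemma countable_dense_seq (R : realType) (X : normedModType R) (D : set X) :
  dense D -> countable D ->
  exists d : nat -> X, forall x e, 0 < e -> exists n, `|x - d n| < e.
Proof.
move=> dD /pfcard_geP[D0|[d]].
  by have [] := dD [set: X] (ex_intro _ 0 I) openT; rewrite D0 => x [].
exists d => x e e0.
have [||y [xy Dy]] := dD (ball x e); first by exists x; exact: ballxx.
  exact: ball_open.
have [n _ dn] := @surj _ _ _ _ d y Dy.
by exists n; rewrite dn; move: xy; rewrite -ball_normE.
Qed.

Section extension.
Variables (R : realType) (X E : normedModType R) (M : R).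
Hypothesis M0 : 0 <= M.
Variable d : nat -> X.
Hypothesis d_dense : forall x e, 0 < e -> exists n, `|x - d n| < e.
Hypothesis E_balls : ball_intersection E.
Implicit Types G H : set (X * E).

(* Such a set is automatically functional: a pair [(0, f)] in it has [f = 0]. *)
Definition bounded_graph G :=
  [/\ G (0, 0),
      forall a x f y g, G (x, f) -> G (y, g) -> G (a *: x + y, a *: f + g)
    & forall x f, G (x, f) -> `|f| <= M * `|x|].

Lemma bounded_graph_sub G x f y g : bounded_graph G ->
  G (x, f) -> G (y, g) -> `|f - g| <= M * `|x - y|.
Proof.
move=> [_ Gl Gb] Gx Gy; apply: (Gb).
by have := Gl (-1) _ _ _ _ Gy Gx; rewrite !scaleN1r ![- _ + _]addrC.
Qed.

Lemma bounded_graph_fun G x f g : bounded_graph G ->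
  G (x, f) -> G (x, g) -> f = g.
Proof.
move=> bG Gf Gg; apply/eqP; rewrite -subr_eq0 -normr_le0.
by have := bounded_graph_sub bG Gf Gg; rewrite subrr normr0 mulr0.
Qed.

(** The points [d n] may lie outside the domain of [G], so each pair [(n, k)] selects a point of the
    domain within [1/(k+1)] of [d n] if there is one, and [(0, 0)] otherwise. *)
Lemma bounded_graph_dense_seq G : bounded_graph G ->
  exists p : nat -> X * E, (forall i, G (p i)) /\
    forall x f e, G (x, f) -> 0 < e -> exists i, `|x - (p i).1| < e.
Proof.
move=> [G0 _ _].
have /choice[p pP] (nk : nat * nat) : exists q, G q /\
    ((exists2 q', G q' & `|q'.1 - d nk.1| < nk.2.+1%:R^-1) ->
      `|q.1 - d nk.1| < nk.2.+1%:R^-1).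
  have [[q Gq qd]|nq] := pselect
    (exists2 q', G q' & `|q'.1 - d nk.1| < nk.2.+1%:R^-1).
    by exists q.
  by exists (0, 0).
exists (fun i => if unpickle i is Some nk then p nk else (0, 0)).
split=> [i|x f e Gx e0]; first by case: unpickle => // nk; exact: (pP nk).1.
have e2 : 0 < e / 2 by rewrite divr_gt0.
have [k ke] := invS_lt e2.
have k0 : 0 < k.+1%:R^-1 :> R by rewrite invr_gt0.
have [n xn] := d_dense x k0.
exists (pickle (n, k)); rewrite pickleK.
have /(_ (ex_intro2 _ _ (x, f) Gx xn))/= pd := (pP (n, k)).2.
rewrite distrC in pd.
have := ler_distD (d n) x (p (n, k)).1; move: pd xn ke {k0 pP}.
by move: k.+1%:R^-1 => c; lra.
Qed.

Lemma bounded_graph_point G (x0 : X) : bounded_graph G ->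
  exists h, forall x f, G (x, f) -> `|h - f| <= M * `|x - x0|.
Proof.
move=> bG; have [p [Gp pd]] := bounded_graph_dense_seq bG.
have [|h hp] := @E_balls (fun i => (p i).2) (fun i => M * `|(p i).1 - x0|).
  (* The radii are admissible by the Lipschitz bound on [G] and the triangle inequality through
     [x0]. *)
  move=> i j; rewrite -mulrDr.
  have Gpi k : G ((p k).1, (p k).2) by case: (p k) (Gp k).
  apply: le_trans (bounded_graph_sub bG (Gpi i) (Gpi j)) _.
  by rewrite ler_wpM2l// [`|(p j).1 - _|]distrC ler_distD.
exists h => x f Gx; apply/ler_addgt0Pr => e e0.
(* Replacing [x] by [(p i).1] costs [M * c] in the value and [M * c] in the radius; the extra 1
   keeps the denominator positive when [M = 0]. *)
pose c := e / (2 * M + 1).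
have M1 : 0 < 2 * M + 1 by rewrite ltr_wpDl// mulr_ge0.
have c0 : 0 < c by rewrite divr_gt0.
have [i xi] := pd x f c Gx c0.
have Gpi : G ((p i).1, (p i).2) by case: (p i) (Gp i).
have fi := bounded_graph_sub bG Gx Gpi.
have := ler_distD (p i).2 h f; rewrite [`|(p i).2 - f|]distrC.
have := hp i.
have : M * `|x - (p i).1| <= M * c by rewrite ler_wpM2l// ltW.
have : M * `|(p i).1 - x0| <= M * c + M * `|x - x0|.
  rewrite -mulrDr ler_wpM2l//; apply: le_trans (ler_distD x _ _) _.
  by rewrite lerD2r distrC ltW.
have ec : e = 2 * (M * c) + c by rewrite /c; field; lra.
lra.
Qed.

Lemma bounded_graph_step G (x0 : X) : bounded_graph G ->
  exists H, [/\ bounded_graph H, G `<=` H & exists h, H (x0, h)].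
Proof.
move=> bG; have [h hP] := bounded_graph_point x0 bG.
have [G0 Gl Gb] := bG.
(* The sum of [G] and the line spanned by [(x0, h)]: the graph of the extension sending [x0] to
   [h]. *)
pose H : set (X * E) := [set q | exists a, G (q.1 - a *: x0, q.2 - a *: h)].
exists H; split; last by exists h, 1; rewrite /= !scale1r !subrr.
- split.
  + by exists 0; rewrite /= !scale0r !subr0.
  + move=> a x f y g [b Gx] [c Gy]; exists (a * b + c) => /=.
    have := Gl a _ _ _ _ Gx Gy.
    have comb (V : lmodType R) (u v w : V) :
        a *: (u - b *: w) + (v - c *: w) = a *: u + v - (a * b + c) *: w.
      by rewrite scalerBr scalerA addrACA -opprD -scalerDl.
    by rewrite !comb.
  + move=> x f [a /= Ga]; have [a0|a0] := eqVneq a 0.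
      by move: Ga; rewrite a0 !scale0r !subr0; exact: Gb.
    (* Scaled by [- a^-1], the pair in [G] becomes [(x0 - a^-1 *: x, h - a^-1 *: f)]; in [hP] both
       [x0] and [h] then cancel. *)
    have comb (V : lmodType R) (u w : V) : - a^-1 *: (u - a *: w) = w - a^-1 *: u.
      by rewrite scaleNr scalerBr scalerA mulVf// scale1r opprB.
    have := Gl (- a^-1) _ _ _ _ Ga G0; rewrite !addr0 !comb => /hP.
    rewrite subKr [x0 - _]addrC addrK normrN !normrZ mulrCA.
    by rewrite ler_pM2l// normr_gt0 invr_eq0.
- by move=> [x f] Gx; exists 0; rewrite /= !scale0r !subr0.
Qed.

Lemma bounded_graph_total G : bounded_graph G ->
  exists H, [/\ bounded_graph H, G `<=` H & forall x, exists f, H (x, f)].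
Proof.
move=> bG.
(* Adjoining [G] inside the predicate lets the empty chain qualify, whose union is empty. *)
have [C CP Ctot|A [bA maxA]] := @Zorn_bigcup _ (fun A => bounded_graph (A `|` G)).
  (* The closure conditions involve at most two pairs, which lie in one bounded graph because the
     chain is totally ordered. *)
  have dir p q : (\bigcup_(A in C) A `|` G) p -> (\bigcup_(A in C) A `|` G) q ->
      exists A, [/\ bounded_graph A, A `<=` \bigcup_(A in C) A `|` G, A p & A q].
    have sub A : C A -> A `|` G `<=` \bigcup_(A in C) A `|` G.
      by move=> CA r [Ar|]; [left; exists A|right].
    move=> [[A CA Ap]|Gp] [[B CB Bq]|Gq].
    - have [AB|BA] := Ctot _ _ CA CB.
        by exists (B `|` G); split; [exact: CP|exact: sub|left; exact: AB|left].
      by exists (A `|` G); split; [exact: CP|exact: sub|left|left; exact: BA].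
    - by exists (A `|` G); split; [exact: CP|exact: sub|left|right].
    - by exists (B `|` G); split; [exact: CP|exact: sub|right|left].
    - by exists G; split=> // r; right.
  split.
  - by right; case: bG.
  - move=> a x f y g Ux Uy; have [A [[_ Al _] AU Ax Ay]] := dir _ _ Ux Uy.
    by apply: AU; exact: Al.
  - by move=> x f Ux; have [A [[_ _ Ab] _ Ax _]] := dir _ _ Ux Ux; exact: Ab.
exists (A `|` G); split=> // x.
have [H [bH AGH [h Hx]]] := bounded_graph_step x bA.
(* If [A] missed [(x, h)], then [H] would be a strictly larger admissible set. *)
exists h; left; apply: contrapT => nA.
apply: (maxA H).
  by split=> [r Ar|/(_ _ Hx)//]; apply: AGH; left.
suff -> : H `|` G = H by [].
by apply/setUidPl => r Gr; apply: AGH; right.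
Qed.

Lemma bounded_operator_extension (Y : set X) (t : X -> E) :
  Y 0 -> (forall a x y, Y x -> Y y -> Y (a *: x + y)) ->
  (forall a x y, Y x -> Y y -> t (a *: x + y) = a *: t x + t y) ->
  (forall x, Y x -> `|t x| <= M * `|x|) ->
  exists T : X -> E,
    [/\ forall a x y, T (a *: x + y) = a *: T x + T y,
        forall y, Y y -> T y = t y & forall x, `|T x| <= M * `|x|].
Proof.
move=> Y0 Yl tl tM.
have [|H [bH GH totH]] := @bounded_graph_total [set q | Y q.1 /\ q.2 = t q.1].
  split=> [|a x f y g /= [Yx ->] [Yy ->]|x f /= [Yx ->]]; last exact: tM.
    split=> //=; apply/esym/eqP; rewrite -normr_le0.
    by have := tM _ Y0; rewrite normr0 mulr0.
  by split; [exact: Yl|rewrite tl].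
have [T TP] := choice totH; have [_ Hl Hb] := bH.
exists T; split=> [a x y|y Yy|x]; last exact: Hb.
  exact: bounded_graph_fun bH (TP _) (Hl _ _ _ _ _ (TP x) (TP y)).
by apply: bounded_graph_fun bH (TP y) _; exact: GH.
Qed.

End extension.

(** * Operator norms and injectivity *)

Lemma opnorm_ge0 (R : realType) (X E : normedModType R) (Y : set X) (t : X -> E) :
  0 <= opnorm Y t.
Proof.
rewrite /opnorm; set S := [set _ | _ in _].
(* [sup] takes the value 0 on a set without supremum. *)
have [[[s Ss] ubS]|/sup_out->//] := pselect (has_sup S).
by apply: le_trans (ub_le_sup ubS Ss); have [x _ <-] := Ss.
Qed.

Lemma opnorm_le (R : realType) (X E : normedModType R) (t : X -> E) (M : R) :
  0 <= M -> (forall x, `|t x| <= M * `|x|) -> opnorm setT t <= M.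
Proof.
move=> M0 tM; apply: ge_sup => [|_ [x [_ x1] <-]].
  by exists `|t 0|, 0 => //; rewrite /= normr0 ler01.
by apply: le_trans (tM x) _; rewrite ler_piMr.
Qed.

Theorem proposition4p4 (R : realType) : one_injective aleph1 (CNstar R).
Proof.
(* Density below [aleph1] means that a dense set of least cardinality is countable, hence [X] is
   separable. *)
move=> X /card_lt_aleph1 cX Y sY t tY.
have [d d_dense] := countable_dense_seq (densP X).1 cX.
have M0 := opnorm_ge0 Y t; have [_ Y0 Yl] := sY; have [tl _] := tY.
(* Taking [M] to be the norm of [t] on [Y] keeps the norm of the extension from growing. *)
have [T [Tl Tt TM]] := bounded_operator_extension M0 d_dense
  (@CNstar_ball_intersection R) Y0 Yl tl (opnormP sY tY).
exists T; split=> //; last exact: opnorm_le.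
by split=> [a x y _ _ //|]; exists (opnorm Y t) => x _; exact: TM.
Qed.
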